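(* Let $(X,D,P)$ be a complete perturbed metric space with exact metric $d=D-P$. Let $S,T:X\to X$ satisfy: (1) $S$ and $T$ are weakly compatible, i.e. $STz=TSz$ for every $z\in X$ with $Sz=Tz$; (2) $T(X)\subseteq S(X)$; (3) $S(X)$ is closed in $(X,d)$; (4) there exists $\alpha\in[0,1)$ such that $D(Tx,Ty)\le\alpha\,D(Sx,Sy)$ for all $x,y\in X$; (5) for this $\alpha$ there exists $\alpha_0\ge 0$ such that $\alpha\,P(Sx,Sy)\le\alpha_0\,d(Sx,Sy)$ for all $x,y\in X$, and $\alpha+\alpha_0<1$. Then $S$ and $T$ have a unique common fixed point in $X$, i.e. there is exactly one $u\in X$ with $Su=Tu=u$.
   Context: A perturbed metric space $(X,D,P)$ consists of a nonempty set $X$ and two functions $D,P:X\times X\to[0,\infty)$ such that $d(x,y):=D(x,y)-P(x,y)$ is a metric on $X$, called the exact metric. Neither $D$ nor $P$ is assumed symmetric. $(X,D,P)$ is called complete if the metric space $(X,d)$ is complete. *)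

(* Defs.v *)
From HB Require Import structures.
From mathcomp Require Import all_boot all_order all_algebra.
From mathcomp Require Import all_classical all_reals all_analysis.

Set Implicit Arguments.
Unset Strict Implicit.
Unset Printing Implicit Defensive.

Import Order.TTheory GRing.Theory Num.Theory.

Local Open Scope classical_set_scope.
Local Open Scope ring_scope.

Record is_metric (R : realType) (X : Type) (d : X -> X -> R) : Prop := {
  is_metric_ge0 : forall x y, 0 <= d x y ;
  is_metric_eq0 : forall x y, d x y = 0 <-> x = y ;
  is_metric_sym : forall x y, d x y = d y x ;
  is_metric_triangle : forall x y z, d x z <= d x y + d y z
}.

Record perturbedMetricSpace (R : realType) := PerturbedMetricSpace {
  pm_sort :> Type ;
  pm_nonempty : [set: pm_sort] !=set0 ;
  pm_D : pm_sort -> pm_sort -> R ;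
  pm_P : pm_sort -> pm_sort -> R ;
  pm_D_ge0 : forall x y, 0 <= pm_D x y ;
  pm_P_ge0 : forall x y, 0 <= pm_P x y ;
  pm_metric : is_metric (fun x y => pm_D x y - pm_P x y)
}.

Definition exact_dist (R : realType) (M : perturbedMetricSpace R) (x y : M) : R :=
  pm_D x y - pm_P x y.

(* The carrier is an arbitrary type: its eqType and choiceType structures, which
   metricType requires, are the classical ones. *)
HB.instance Definition _ (R : realType) (M : perturbedMetricSpace R) :=
  gen_eqMixin (pm_sort M).
HB.instance Definition _ (R : realType) (M : perturbedMetricSpace R) :=
  gen_choiceMixin (pm_sort M).

(* Only needed so that cvg, which mentions lim, can be stated on M. *)
HB.instance Definition _ (R : realType) (M : perturbedMetricSpace R) :=
  isPointed.Build (pm_sort M) (sval (cid (pm_nonempty M))).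

Section exact_metric_space.
Context (R : realType) (M : perturbedMetricSpace R).

Let dist_xx (x : M) : exact_dist x x = 0.
Proof. exact/(is_metric_eq0 (pm_metric M)). Qed.

Let dist_positivity (x y : M) : exact_dist x y = 0 -> x = y.
Proof. by move/(is_metric_eq0 (pm_metric M)). Qed.

Let dist_sym (x y : M) : exact_dist x y = exact_dist y x.
Proof. exact: (is_metric_sym (pm_metric M)). Qed.

Let dist_triangle (y x z : M) :
  exact_dist x z <= exact_dist x y + exact_dist y z.
Proof. exact: (is_metric_triangle (pm_metric M)). Qed.

(* The topology and uniformity on M are those of the exact metric. *)
HB.instance Definition _ := isMetric.Build R (pm_sort M)
  dist_xx dist_positivity dist_sym dist_triangle.

End exact_metric_space.

Lemma mdist_exact (R : realType) (M : perturbedMetricSpace R) (x y : M) :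
  mdist x y = exact_dist x y.
Proof. by []. Qed.

(* Completeness of (M, d), in the form of the axiom cauchy_cvg of completeType. *)
Definition pm_complete (R : realType) (M : perturbedMetricSpace R) : Prop :=
  forall F : set_system M, ProperFilter F -> cauchy F -> cvg F.

Definition weakly_compatible (X : Type) (S T : X -> X) : Prop :=
  forall z, S z = T z -> S (T z) = T (S z).

(* Main.v *)
Require Import Defs.
From mathcomp Require Import all_boot all_order all_algebra.
From mathcomp Require Import all_classical all_reals all_analysis.
From mathcomp Require Import lra.

(** Since [P] is nonnegative, [d(Tx,Ty) <= D(Tx,Ty) <= alpha * D(Sx,Sy) =
    alpha * d(Sx,Sy) + alpha * P(Sx,Sy) <= (alpha + alpha0) * d(Sx,Sy)],
    so [T] is a [d]-contraction relative to [S] and Jungck's argument applies: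
    the iterates [T x_n = S x_{n+1}] are Cauchy, their limit [S z] satisfies
    [S z = T z], and by weak compatibility this point of coincidence is the
    common fixed point. *)

Import Order.TTheory GRing.Theory Num.Theory.
Import numFieldNormedType.Exports.

Local Open Scope classical_set_scope.
Local Open Scope ring_scope.

Lemma le_contract_eq0 (R : realDomainType) (k a : R) :
  k < 1 -> 0 <= a -> a <= k * a -> a = 0.
Proof. by move=> k1 a0 aka; nra. Qed.

Section contracting_sequence.
Context {R : realType} {X : metricType R}.
Context (k : R) (k_ge0 : 0 <= k) (k_lt1 : k < 1) (u : nat -> X)
  (u_contracting :
    forall n, mdist (u n.+1) (u n.+2) <= k * mdist (u n) (u n.+1)).

Lemma contracting_mdist_le_geometric n :
  mdist (u n) (u n.+1) <= mdist (u 0) (u 1) * k ^+ n.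
Proof.
elim: n => [|n IHn]; first by rewrite expr0 mulr1.
by rewrite exprS mulrCA (le_trans (u_contracting n))// ler_wpM2l.
Qed.

(** Induct through [u n.+1]: scaled by [1 - k], the first step costs [1 - k] times
    [mdist (u n) (u n.+1)], and the rest at most [mdist (u n.+1) (u n.+2)], hence [k] times it; the
    weights add up to 1. The bound is uniform in [p]. *)
Lemma contracting_mdist_tail n p :
  (1 - k) * mdist (u n) (u (n + p)%N) <= mdist (u n) (u n.+1).
Proof.
elim: p n => [|p IHp] n; first by rewrite addn0 mdistxx mulr0 mdist_ge0.
have := IHp n.+1; rewrite addSnnS => tail.
have k1 : 0 <= 1 - k by rewrite subr_ge0 ltW.
have := ler_wpM2l k1 (metric_triangle (u n) (u n.+1) (u (n + p.+1)%N)).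
have := u_contracting n.
lra.
Qed.

Lemma contracting_cauchy : cauchy (u @ \oo).
Proof.
apply: cauchy_exP => e e0; have k10 : 0 < 1 - k by rewrite subr_gt0.
have geo : geometric (mdist (u 0) (u 1)) k @ \oo --> 0.
  by apply: cvg_geometric; rewrite ger0_norm.
(* The factor [1 - k] matches the one in the tail bound, so the ball of radius [e] around [u N]
   contains every later term. *)
have [N _ small] : \forall n \near \oo, mdist (u 0) (u 1) * k ^+ n < (1 - k) * e.
  by apply: (cvgr_lt 0 geo); rewrite mulr_gt0.
exists (u N); exists N => // n /= Nn.
rewrite ballEmdist /= -(ltr_pM2l k10) -(subnKC Nn).
apply: le_lt_trans (contracting_mdist_tail _ _) _.
exact: le_lt_trans (contracting_mdist_le_geometric _) (small N (leqnn N)).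
Qed.

End contracting_sequence.

Lemma coincidence_point (R : realType) (M : perturbedMetricSpace R)
    (S T : M -> M) (k : R) :
  pm_complete M -> range T `<=` range S -> closed (range S) ->
  0 <= k -> k < 1 ->
  (forall x y, mdist (T x) (T y) <= k * mdist (S x) (S y)) ->
  exists z, S z = T z.
Proof.
move=> M_complete T_sub_S S_closed k0 k1 ctr.
(* [g] picks preimages under [S] of the values of [T]; iterating it gives the Jungck sequence. *)
have /choice[g Sg] x : exists y, S y = T x.
  by have [y _ Sy] := T_sub_S (T x) (imageT T x); exists y.
have [x0 _] := pm_nonempty M.
pose v n := iter n g x0; pose u n := T (v n).
have Suv n : S (v n.+1) = u n by apply: Sg.
have u_cvg : cvg (u @ \oo).
  apply: M_complete; apply: (contracting_cauchy k k0 k1) => n.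
  by have := ctr (v n.+1) (v n.+2); rewrite !Suv.
have [z _ Sz] : range S (lim (u @ \oo)).
  apply: (closed_cvg _ S_closed _ _ u_cvg).
  by apply: nearW => n; apply: T_sub_S; exists (v n).
exists z; rewrite Sz.
(* [T z] is a limit of [u] too: [u n.+1] is at most [k] times as far from [T z] as [u n] is from
   [S z], the limit already found. *)
apply: (cvg_unique _ u_cvg); first exact: metric_hausdorff.
rewrite /= -cvg_shiftS; apply/metricType_numDomainType.cvgrPdist_lt => e e0.
have := metricType_numDomainType.cvgr_dist_lt u_cvg e0.
move=> /(_ _); apply: filterS => n; apply: le_lt_trans.
rewrite (le_trans (ctr z (v n.+1)))// Sz Suv.
by rewrite ler_piMl ?mdist_ge0// ltW.
Qed.

Theorem theorem3p22 (R : realType) (M : perturbedMetricSpace R)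
    (M_complete : pm_complete M) (S T : M -> M)
    (ST_compatible : weakly_compatible S T)
    (T_sub_S : range T `<=` range S)
    (S_closed : closed (range S))
    (alpha : R) (alpha_ge0 : 0 <= alpha) (alpha_lt1 : alpha < 1)
    (contraction : forall x y : M,
      pm_D (T x) (T y) <= alpha * pm_D (S x) (S y))
    (alpha0 : R) (alpha0_ge0 : 0 <= alpha0)
    (perturbation : forall x y : M,
      alpha * pm_P (S x) (S y) <= alpha0 * exact_dist (S x) (S y))
    (alpha_sum : alpha + alpha0 < 1) :
  exists! u : M, S u = u /\ T u = u.
Proof.
have ctr x y : mdist (T x) (T y) <= (alpha + alpha0) * mdist (S x) (S y).
  have := contraction x y; have := perturbation x y.
  have := pm_P_ge0 (T x) (T y).
  rewrite !mdist_exact /exact_dist; lra.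
(* At two coincidence points the contraction bounds [mdist (T x) (T y)] by a factor below 1 times
   itself. This yields both the fixed point and its uniqueness. *)
have inj x y : S x = T x -> S y = T y -> T x = T y.
  move=> Sx Sy; apply: mdist_positivity.
  apply: (le_contract_eq0 _ _ _ alpha_sum (mdist_ge0 _ _)).
  by rewrite -{2}Sx -{2}Sy.
have [z STz] : exists z, S z = T z.
  by apply: coincidence_point ctr => //; apply: addr_ge0.
(* Weak compatibility makes [T z] a coincidence point as well, so [inj] can compare it with [z]. *)
have STu : S (T z) = T (T z) by rewrite ST_compatible// STz.
have Tu : T (T z) = T z by apply: inj.
exists (T z); split; first by rewrite STu.
move=> w [Sw Tw]; rewrite -[RHS]Tw; apply: inj => //.
by rewrite Sw Tw.
Qed.
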